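(* Let $d\ge 2$. For every integer $m\ge 2d$ there exists a probability measure $\mu$ on $\mathbb{R}^d$, absolutely continuous with respect to Lebesgue measure, that cannot be partitioned into $2m$ equal parts by an $m$-fan; that is, for every set of $m$ hyperplanes in $\mathbb{R}^d$ all containing a common $(d-2)$-flat, it is not the case that the complement of their union consists of $2m$ parts each of $\mu$-measure $\frac{1}{2m}$.
   Context: A $(d-2)$-flat is a $(d-2)$-dimensional affine subspace of $\mathbb{R}^d$. An $m$-fan is a set of $m$ hyperplanes in $\mathbb{R}^d$ passing through a common $(d-2)$-flat. *)

(* Defs.v *)
From HB Require Import structures.
From mathcomp Require Import all_boot all_order all_algebra.
From mathcomp Require Import all_classical all_reals all_analysis.
Set Implicit Arguments. Unset Strict Implicit. Unset Printing Implicit Defensive.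
Import Order.TTheory GRing.Theory Num.Theory.
Import numFieldNormedType.Exports.
Local Open Scope classical_set_scope.
Local Open Scope ring_scope.

Notation Rd_borel R d := (g_sigma_algebraType (@open 'rV[R%type]_d)).

Definition lebesgue_null (R : realType) (d : nat) (N : set 'rV[R]_d) : Prop :=
  forall e : R, 0 < e ->
    exists a b : nat -> 'rV[R]_d,
      (forall k (i : 'I_d), a k ord0 i <= b k ord0 i) /\
      N `<=` \bigcup_k [set x | forall i : 'I_d, a k ord0 i <= x ord0 i <= b k ord0 i] /\
      (\sum_(0 <= k <oo) (\prod_(i < d) (b k ord0 i - a k ord0 i))%:E < e%:E)%E.

Definition abs_cont_lebesgue (R : realType) (d : nat)
    (mu : probability (Rd_borel R d) R) : Prop :=
  forall N : set (Rd_borel R d), measurable N -> lebesgue_null N -> mu N = 0%E.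

Definition hyperplane (R : realType) (d : nat) (a : 'rV[R]_d) (c : R)
    : set 'rV[R]_d :=
  [set x | \sum_(i < d) a ord0 i * x ord0 i = c].

(* The affine flat p + rowspace(F). Its dimension is \rank F. *)
Definition flat (R : realType) (d : nat) (p : 'rV[R]_d) (F : 'M[R]_d)
    : set 'rV[R]_d :=
  [set x | (x - p <= F)%MS].

Definition is_mfan (R : realType) (d m : nat)
    (a : 'I_m -> 'rV[R]_d) (c : 'I_m -> R) : Prop :=
  (forall i, a i != 0) /\
  (forall i j, hyperplane (a i) (c i) = hyperplane (a j) (c j) -> i = j) /\
  exists (p : 'rV[R]_d) (F : 'M[R]_d),
    \rank F = (d - 2)%N /\ forall i, flat p F `<=` hyperplane (a i) (c i).

Definition fan_complement (R : realType) (d m : nat)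
    (a : 'I_m -> 'rV[R]_d) (c : 'I_m -> R) : set 'rV[R]_d :=
  ~` \bigcup_(i in [set: 'I_m]) hyperplane (a i) (c i).

Definition fan_equipartitions (R : realType) (d m : nat)
    (mu : probability (Rd_borel R d) R)
    (a : 'I_m -> 'rV[R]_d) (c : 'I_m -> R) : Prop :=
  let U := fan_complement a c in
  ([set connected_component U x | x in U] #= [set: 'I_(2 * m)])%card /\
  forall x, U x ->
    mu (connected_component U x : set (Rd_borel R d)) = ((2 * m)%:R^-1)%:E.

(* Main.v *)
Require Import Defs.
From HB Require Import structures.
From mathcomp Require Import all_boot all_order all_algebra.
From mathcomp Require Import all_classical all_reals all_analysis.
From mathcomp Require Import measurable_realfun.
From mathcomp Require Import lra ring zify.
Import Order.TTheory GRing.Theory Num.Theory.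
Import numFieldNormedType.Exports.
Local Open Scope classical_set_scope.
Local Open Scope ring_scope.

(* The measure is the average of the uniform measures on 2m - 1 small cubes. A
   cube missed by every hyperplane of the fan lies in one component of the
   complement, which then has mass at least 1/(2m-1) > 1/(2m); so an
   equipartitioning fan meets all the cubes. A pencil of hyperplanes (a plane in
   the space of linear forms in d + 1 homogeneous coordinates) has 2(d - 1)
   parameters and its m members have one each, while meeting 2m - 1 cubes in
   prescribed members imposes 2m - 1 > 2(d - 1) + m conditions. To turn this into
   a proof, suppose that for each of the n^(d(2m-1)) ways of placing the cubes on
   a grid of step 1/n some fan meets them all. The parameters of that fan rounded
   to precision 1/n, all but one coordinate of each cube (one along which its
   hyperplane is not too flat), and bounded extra data determine the placement,
   hence n^(d(2m-1)) <= C n^(2(d-1) + m + (d-1)(2m-1)), which is absurd for large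
   n. *)

Set Implicit Arguments. Unset Strict Implicit. Unset Printing Implicit Defensive.

(** * Pencils of linear forms in normalized coordinates *)

Section Pencil.
Variables (R : realFieldType) (e : nat).

(* Homogeneous coordinates, ordered so that the form [(c, a)] evaluates to [a . x - c]. *)
Definition hom (x : 'I_e.+1 -> R) (k : 'I_e.+2) : R :=
  if unlift ord0 k is Some l then x l else -1.

(* [dual1], [dual2] span a pencil normalized to be (1, 0) and (0, 1) at the coordinates
   [p] and [lift p q]; [u] and [v] list their other coordinates. *)
Definition dual1 (p : 'I_e.+2) (q : 'I_e.+1) (u : 'I_e -> R) (k : 'I_e.+2) : R :=
  if unlift p k is Some l then if unlift q l is Some i then u i else 0 else 1.
Definition dual2 (p : 'I_e.+2) (q : 'I_e.+1) (v : 'I_e -> R) (k : 'I_e.+2) : R :=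
  if unlift p k is Some l then if unlift q l is Some i then v i else 1 else 0.

(** Up to scale, a member of the pencil: [b] tells which basis form has the larger coefficient,
    scaled to 1, so that the ratio [t] can be kept in [-1, 1]. *)
Definition pencil p q (b : bool) (u v : 'I_e -> R) (t : R) (k : 'I_e.+2) : R :=
  if b then dual1 p q u k + t * dual2 p q v k
  else dual2 p q v k + t * dual1 p q u k.

Lemma dual1_le1 p q u k : (forall i, `|u i| <= 1) -> `|dual1 p q u k| <= 1.
Proof.
move=> u1; rewrite /dual1; case: unliftP => [l _|_]; last by rewrite normr1.
by case: unliftP => [i _|_]; rewrite ?normr0.
Qed.

Lemma dual2_le1 p q u k : (forall i, `|u i| <= 1) -> `|dual2 p q u k| <= 1.
Proof.
move=> u1; rewrite /dual2; case: unliftP => [l _|_]; last by rewrite normr0.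
by case: unliftP => [i _|_]; rewrite ?normr1.
Qed.

Lemma dual1_dist p q u u' k (h : R) : 0 <= h -> (forall i, `|u i - u' i| <= h) ->
  `|dual1 p q u k - dual1 p q u' k| <= h.
Proof.
move=> h0 uu; rewrite /dual1; case: unliftP => [l _|_]; last by rewrite subrr normr0.
by case: unliftP => [i _|_]; rewrite ?subrr ?normr0.
Qed.

Lemma dual2_dist p q u u' k (h : R) : 0 <= h -> (forall i, `|u i - u' i| <= h) ->
  `|dual2 p q u k - dual2 p q u' k| <= h.
Proof.
move=> h0 uu; rewrite /dual2; case: unliftP => [l _|_]; last by rewrite subrr normr0.
by case: unliftP => [i _|_]; rewrite ?subrr ?normr0.
Qed.

Let mul_dist (x y t x' y' t' h : R) : 0 <= h ->
  `|x - x'| <= h -> `|y - y'| <= h -> `|t - t'| <= h -> `|y| <= 1 -> `|t'| <= 1 ->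
  `|(x + t * y) - (x' + t' * y')| <= 3 * h.
Proof.
move=> h0 hx hy ht hy1 ht1.
have -> : x + t * y - (x' + t' * y') = (x - x') + ((t - t') * y + t' * (y - y')) by ring.
have H1 : `|(t - t') * y| <= h.
  by rewrite normrM -[leRHS]mulr1; apply: ler_pM.
have H2 : `|t' * (y - y')| <= h.
  by rewrite normrM -[leRHS]mul1r; apply: ler_pM.
have := ler_normD (x - x') ((t - t') * y + t' * (y - y')).
have := ler_normD ((t - t') * y) (t' * (y - y')).
lra.
Qed.

Lemma pencil_dist p q b (u v u' v' : 'I_e -> R) (t t' h : R) k : 0 <= h ->
  (forall i, `|u i| <= 1) -> (forall i, `|v i| <= 1) -> `|t'| <= 1 ->
  (forall i, `|u i - u' i| <= h) -> (forall i, `|v i - v' i| <= h) -> `|t - t'| <= h ->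
  `|pencil p q b u v t k - pencil p q b u' v' t' k| <= 3 * h.
Proof.
move=> h0 u1 v1 t1 uu vv tt; rewrite /pencil.
by case: b; apply: mul_dist => //;
  first [exact: dual1_dist | exact: dual2_dist | exact: dual1_le1 | exact: dual2_le1].
Qed.

Lemma pencil_le2 p q b (u v : 'I_e -> R) (t : R) k :
  (forall i, `|u i| <= 1) -> (forall i, `|v i| <= 1) -> `|t| <= 1 ->
  `|pencil p q b u v t k| <= 2.
Proof.
move=> u1 v1 t1; have d1 := dual1_le1 p q k u1; have d2 := dual2_le1 p q k v1.
rewrite /pencil; case: b; apply: le_trans (ler_normD _ _) _; rewrite normrM;
  rewrite -[2]/(1 + 1); apply: lerD => //; rewrite -[leRHS]mulr1; exact: ler_pM.
Qed.

Lemma pencil_pivot p q b (u v : 'I_e -> R) (t : R) :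
  exists k, pencil p q b u v t k = 1.
Proof.
case: b.
  by exists p; rewrite /pencil /dual1 /dual2 unlift_none mulr0 addr0.
by exists (lift p q); rewrite /pencil /dual1 /dual2 liftK unlift_none mulr0 addr0.
Qed.

(* Cramer's rule for the 2 x 2 minor of largest absolute value. *)
Lemma pencil_basis (b1 b2 : 'I_e.+2 -> R) :
  (exists k l, b1 k * b2 l != b1 l * b2 k) ->
  exists p q (u v : 'I_e -> R),
    [/\ forall i, `|u i| <= 1, forall i, `|v i| <= 1,
     forall k, b1 k = b1 p * dual1 p q u k + b1 (lift p q) * dual2 p q v k &
     forall k, b2 k = b2 p * dual1 p q u k + b2 (lift p q) * dual2 p q v k].
Proof.
pose M (z : 'I_e.+2 * 'I_e.+2) := b1 z.1 * b2 z.2 - b1 z.2 * b2 z.1.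
case=> k0 [l0 kl0].
have [[p q'] _ /= maxM] := @Order.TotalTheory.arg_maxP _ _ _ (k0, l0) predT (fun z => `|M z|) isT.
have {kl0 k0 l0} M0 : M (p, q') != 0.
  rewrite -normr_gt0; apply: lt_le_trans (maxM (k0, l0) isT).
  by rewrite normr_gt0 /M subr_eq0.
have /unlift_some[q q'E _] : p != q'.
  by apply: contra_neq M0 => ->; rewrite /M subrr.
exists p, q.
exists (fun i => M (lift p (lift q i), q') / M (p, q')).
exists (fun i => M (p, lift p (lift q i)) / M (p, q')).
split.
- by move=> i; rewrite normrM normfV ler_pdivrMr ?normr_gt0// mul1r maxM.
- by move=> i; rewrite normrM normfV ler_pdivrMr ?normr_gt0// mul1r maxM.
- move=> k; rewrite /dual1 /dual2; case: unliftP => [l ->|->]; last by ring.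
  case: unliftP => [i ->|->]; last by ring.
  apply/(mulIf M0); rewrite mulrDl !mulrA !mulfVK// /M q'E /=; ring.
- move=> k; rewrite /dual1 /dual2; case: unliftP => [l ->|->]; last by ring.
  case: unliftP => [i ->|->]; last by ring.
  apply/(mulIf M0); rewrite mulrDl !mulrA !mulfVK// /M q'E /=; ring.
Qed.

Lemma pencil_normalize (b1 b2 : 'I_e.+2 -> R) p q u v (s t : R) :
  (forall k, b1 k = b1 p * dual1 p q u k + b1 (lift p q) * dual2 p q v k) ->
  (forall k, b2 k = b2 p * dual1 p q u k + b2 (lift p q) * dual2 p q v k) ->
  (exists k, s * b1 k + t * b2 k != 0) ->
  exists b r lam, [/\ `|r| <= 1, lam != 0 &
    forall k, s * b1 k + t * b2 k = lam * pencil p q b u v r k].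
Proof.
move=> b1E b2E nz.
pose x := s * b1 p + t * b2 p; pose y := s * b1 (lift p q) + t * b2 (lift p q).
have wE k : s * b1 k + t * b2 k = x * dual1 p q u k + y * dual2 p q v k.
  by rewrite b1E b2E /x /y; ring.
have xy : (x != 0) || (y != 0).
  rewrite -negb_and; apply/negP => /andP[/eqP x0 /eqP y0].
  by case: nz => k; rewrite wE x0 y0 !mul0r addr0 eqxx.
have [yx|/ltW xley] := leP `|y| `|x|.
  have x0 : x != 0.
    by apply: contraTneq xy => x0; move: yx; rewrite x0 normr0 normr_le0 => /eqP ->; rewrite eqxx.
  exists true, (y / x), x; split=> //.
    by rewrite normrM normfV ler_pdivrMr ?normr_gt0// mul1r.
  by move=> k; rewrite wE /pencil mulrDr (mulrA x (y / x)) (mulrC x (y / x)) mulfVK.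
have y0 : y != 0.
  by apply: contraTneq xy => y0; move: xley; rewrite y0 normr0 normr_le0 => /eqP ->; rewrite eqxx.
exists false, (x / y), y; split=> //.
  by rewrite normrM normfV ler_pdivrMr ?normr_gt0// mul1r.
by move=> k; rewrite wE /pencil mulrDr (mulrA y (x / y)) (mulrC y (x / y)) mulfVK// addrC.
Qed.

Lemma sum_hom w (x : 'I_e.+1 -> R) :
  \sum_k w k * hom x k = - w ord0 + \sum_l w (lift ord0 l) * x l.
Proof.
rewrite big_ord_recl {1}/hom unlift_none mulrN1; congr (_ + _).
by apply: eq_bigr => l _; rewrite /hom liftK.
Qed.

Lemma hom_dist (x y : 'I_e.+1 -> R) k (h : R) : 0 <= h ->
  (forall l, `|x l - y l| <= h) -> `|hom x k - hom y k| <= h.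
Proof.
by move=> h0 xy; rewrite /hom; case: unliftP => // _; rewrite subrr normr0.
Qed.

Lemma hom_le1 (x : 'I_e.+1 -> R) k :
  (forall l, `|x l| <= 1) -> `|hom x k| <= 1.
Proof. by move=> x1; rewrite /hom; case: unliftP => // _; rewrite normrN1. Qed.

Lemma norm_sum_le (I : finType) (w x : I -> R) (c h : R) :
  (forall k, `|w k| <= c) -> (forall k, `|x k| <= h) ->
  `|\sum_k w k * x k| <= c * h * #|I|%:R.
Proof.
move=> wc xh; apply: le_trans (ler_norm_sum _ _ _) _.
rewrite mulr_natr -sumr_const; apply: ler_sum => k _.
by rewrite normrM; apply: ler_pM.
Qed.

(** Were all normal coordinates below 1/(e + 1), the incidence equation at a point of [-1, 1]^(e +
    1) would force the offset below 1 too, and no coordinate could equal 1. *)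
Lemma pencil_slope (w : 'I_e.+2 -> R) (x : 'I_e.+1 -> R) :
  (exists k, w k = 1) -> (forall l, `|x l| <= 1) ->
  \sum_k w k * hom x k = 0 -> exists l, e.+1%:R^-1 <= `|w (lift ord0 l)|.
Proof.
move=> [k wk] x1 wx; apply/existsP; apply: contraPT wx.
rewrite negb_exists => /forallP wlt; rewrite sum_hom => /eqP.
rewrite addrC subr_eq0 => /eqP w0.
have {}wlt l : `|w (lift ord0 l)| < e.+1%:R^-1 by rewrite ltNge.
have e1 : e.+1%:R^-1 <= 1 :> R by rewrite invf_le1 ?ltr0n// ler1n.
have : `|w k| < 1.
  case: (unliftP ord0 k) => [l ->|->]; first exact: lt_le_trans (wlt l) e1.
  rewrite -w0; apply: le_lt_trans (ler_norm_sum _ _ _) _.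
  have -> : 1 = \sum_(l < e.+1) e.+1%:R^-1 :> R.
    by rewrite sumr_const card_ord -[RHS]mulr_natr mulVf ?pnatr_eq0.
  apply: ltr_sum => [|l _]; first by apply/hasP; exists ord0; rewrite ?mem_index_enum.
  by rewrite normrM; apply: le_lt_trans (wlt l); rewrite -[leRHS]mulr1 ler_pM.
by rewrite wk normr1 ltxx.
Qed.
End Pencil.

(** * Counting the placements of cubes that pencils can meet *)

Lemma modn_close a b s : (a <= b + s)%N -> (b <= a + s)%N ->
  (a = b %[mod s.+1])%N -> a = b.
Proof.
wlog ab : a b / (a <= b)%N.
  by move=> W; case/orP: (leq_total a b) => ? ? ? ?; [|symmetry]; apply: W.
move=> _ ba /esym/eqP; rewrite eqn_mod_dvd// => dv.
by have := dvdn_leq _ dv; lia.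
Qed.

Section Counting.
Variables (R : archiRealFieldType) (e m N : nat).

(* [slack] exceeds, in grid steps, the possible distance along the steep
   coordinate between two cubes that agree on the rest of the code. *)
Definition slack := (7 * e.+2 * e.+1).+1.

(* The part of the code whose size does not depend on [n]: which hyperplane meets
   each cube, the pivots of the pencil, which basis vector is dominant in each
   hyperplane, a coordinate along which that hyperplane is steep for each cube, and
   the position of the cube along this coordinate modulo [slack]. *)
Definition skeleton : finType :=
  ({ffun 'I_N -> 'I_m} * ('I_e.+2 * 'I_e.+1) * {ffun 'I_m -> bool}
   * {ffun 'I_N -> 'I_e.+1} * {ffun 'I_N -> 'I_slack})%type.

(** Indices of the real parameters: the coordinates [u] and [v] of the pencil and one ratio per
    hyperplane, 2(d - 1) + m in all for d = e + 1. *)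
Definition parameter : finType := ('I_e + 'I_e + 'I_m)%type.

Variable n : nat.
Hypothesis n_gt0 : (0 < n)%N.

Definition grid (Y : 'I_N * 'I_e.+1 -> 'I_n) (j : 'I_N) (l : 'I_e.+1) : R :=
  (Y (j, l))%:R / n%:R.

Definition line (pq : 'I_e.+2 * 'I_e.+1) (b : 'I_m -> bool) (r : parameter -> R) (i : 'I_m) :=
  pencil pq.1 pq.2 (b i) (fun k => r (inl (inl k))) (fun k => r (inl (inr k))) (r (inr i)).

(** Incidence is only approximate because the corner [grid Y j] replaces the point where the cube is
    hit: coefficients at most 2, a shift of at most 1/n, e + 2 terms. *)
Definition nearly_hit (Y : 'I_N * 'I_e.+1 -> 'I_n) (c : skeleton) (r : parameter -> R) :=
  let: (f, pq, b, idx, rho) := c in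
  [/\ forall k, `|r k| <= 1,
   forall j, `|\sum_k line pq b r (f j) k * hom (grid Y j) k| <= 2 * n%:R^-1 * e.+2%:R,
   forall j, e.+1%:R^-1 <= `|line pq b r (f j) (lift ord0 (idx j))| &
   forall j, rho j = inord (Y (j, idx j) %% slack)].

Lemma grid_le1 Y j l : `|grid Y j l| <= 1.
Proof.
rewrite ger0_norm ?divr_ge0// ler_pdivrMr ?ltr0n// mul1r ler_nat.
exact: ltnW.
Qed.

(** Corners of corresponding cubes can differ only along the steep coordinate [idx j]; there the two
    near incidences keep them fewer than [slack] steps apart, and equal residues modulo [slack] make
    them equal. *)
Lemma nearly_hit_inj Y Y' c (r r' : parameter -> R) :
  nearly_hit Y c r -> nearly_hit Y' c r' ->
  (forall k, `|r k - r' k| <= n%:R^-1) ->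
  (forall j l, Y (j, lift (c.1.2 j) l) = Y' (j, lift (c.1.2 j) l)) ->
  Y =1 Y'.
Proof.
case: c => [[[[f pq] b] idx] rho] /= [r1 hY big_l rhoE] [r1' hY' _ rhoE'] rr eqY.
have h0 : 0 <= n%:R^-1 :> R by rewrite invr_ge0.
have idxE j : Y (j, idx j) = Y' (j, idx j).
  set i := idx j.
  pose w := line pq b r (f j); pose w' := line pq b r' (f j).
  have wE : \sum_k w k * hom (grid Y j) k - \sum_k w k * hom (grid Y' j) k
            = w (lift ord0 i) * (grid Y j i - grid Y' j i).
    rewrite !sum_hom opprD addrACA subrr add0r -sumrB (bigD1 i)//= big1 ?addr0 ?mulrBr//.
    move=> l li; case: (unliftP i l) li => [l' ->|->]; last by rewrite eqxx.
    by rewrite /grid eqY subrr.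
  have ww' : \sum_k w k * hom (grid Y' j) k = \sum_k (w k - w' k) * hom (grid Y' j) k
     + \sum_k w' k * hom (grid Y' j) k.
    by rewrite -big_split/=; apply: eq_bigr => k _; rewrite mulrBl subrK.
  have Hd : `|\sum_k (w k - w' k) * hom (grid Y' j) k| <= 3 * n%:R^-1 * 1 * e.+2%:R.
    rewrite -[X in _ * X%:R]card_ord; apply: norm_sum_le => k.
      exact: pencil_dist.
    by apply: hom_le1 => l; exact: grid_le1.
  (* In units of (e + 2)/n, 7 = 2 + 2 + 3: 2 for each near incidence and 3 for replacing [w] by
     [w']. *)
  have H7 : `|w (lift ord0 i) * (grid Y j i - grid Y' j i)| <= 7 * e.+2%:R / n%:R.
    rewrite -wE ww'; have := hY j; have := hY' j; rewrite -/w -/w'.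
    set S1 := \sum_k w k * _; set S2 := \sum_k _ * _ in Hd *.
    set S3 := \sum_k _ * _ => A1 A2.
    apply: le_trans (ler_normB _ _) _; have := ler_normD S2 S3.
    have -> : 7 * e.+2%:R / n%:R = 7 * (n%:R^-1 * e.+2%:R) :> R by rewrite mulrAC mulrA.
    move: A1 A2 Hd; rewrite mulr1 -!mulrA; move: (_^-1 * _) => z.
    move: `|S1| `|S2| `|S3| `|_ + _| => s1 s2 s3 s4; lra.
  (* Dividing by the slope, at least 1/(e + 1), gives the factor e + 1 in [slack]. *)
  have H8 : `|grid Y j i - grid Y' j i| * n%:R <= (7 * e.+2 * e.+1)%:R.
    move: H7; rewrite normrM ler_pdivlMr ?ltr0n// => H7.
    rewrite natrM -ler_pdivrMr ?ltr0n// mulrC natrM; apply: le_trans H7.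
    by rewrite -mulrA; apply: ler_wpM2r; rewrite ?mulr_ge0// big_l.
  have : `|(Y (j, i))%:Z - (Y' (j, i))%:Z| <= (7 * e.+2 * e.+1)%:Z.
    rewrite -(ler_int R) intr_norm rmorphB /= -!pmulrn.
    move: H8; rewrite -mulrBl normrM mulrC mulrCA normfV normr_nat.
    by rewrite divff ?mulr1// pnatr_eq0 -lt0n.
  have : (Y (j, i) = Y' (j, i) %[mod slack])%N.
    have := rhoE j; rewrite rhoE' => /(congr1 val) /=.
    by rewrite !inordK ?ltn_pmod//; move=> /esym.
  rewrite /slack; move: (7 * _ * _)%N => s modE le_s.
  by apply/val_inj/(modn_close _ _ modE); lia.
case=> j l; case: (unliftP (idx j) l) => [l' ->|->]; [exact: eqY|exact: idxE].
Qed.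

(** Normalizes the pencil and each of its members, then moves each hit point to the corner of its
    cube. *)
Lemma nearly_hit_intro (Y : 'I_N * 'I_e.+1 -> 'I_n) (b1 b2 : 'I_e.+2 -> R)
    (s t : 'I_m -> R) (f : 'I_N -> 'I_m) (x : 'I_N -> 'I_e.+1 -> R) :
  (exists k l, b1 k * b2 l != b1 l * b2 k) ->
  (forall i, exists k, s i * b1 k + t i * b2 k != 0) ->
  (forall j l, (Y (j, l))%:R / n%:R <= x j l <= (Y (j, l)).+1%:R / n%:R) ->
  (forall j, \sum_k (s (f j) * b1 k + t (f j) * b2 k) * hom (x j) k = 0) ->
  exists c r, nearly_hit Y c r.
Proof.
move=> indep nz xY hit.
have [p [q [u [v [u1 v1 b1E b2E]]]]] := pencil_basis indep.
have /fin_all_exists[g gP] : forall i, exists brl : bool * R * R,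
    [/\ `|brl.1.2| <= 1, brl.2 != 0 &
    forall k, s i * b1 k + t i * b2 k = brl.2 * pencil p q brl.1.1 u v brl.1.2 k].
  move=> i; have [b [r [lam brl]]] := pencil_normalize b1E b2E (nz i).
  by exists (b, r, lam).
pose b := [ffun i => (g i).1.1].
pose r (k : parameter) := match k with inl (inl i) => u i | inl (inr i) => v i
                           | inr i => (g i).1.2 end.
have lineE i : line (p, q) b r i = pencil p q (g i).1.1 u v (g i).1.2.
  by rewrite /line/= ffunE.
have n1 : 0 <= n%:R^-1 :> R by rewrite invr_ge0.
have hit' j : \sum_k line (p, q) b r (f j) k * hom (x j) k = 0.
  have [_ lam0 gE] := gP (f j).
  apply: (mulfI lam0); rewrite mulr0 mulr_sumr -[RHS](hit j); apply: eq_bigr => k _.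
  by rewrite mulrA lineE gE.
have x1 j l : `|x j l| <= 1.
  have /andP[x0 x1] := xY j l; rewrite ger0_norm ?(le_trans _ x0) ?divr_ge0//.
  by apply: le_trans x1 _; rewrite ler_pdivrMr ?ltr0n// mul1r ler_nat.
have xg j l : `|grid Y j l - x j l| <= n%:R^-1.
  have /andP[] := xY j l; rewrite -natr1 mulrDl mul1r -/(grid Y j l) => x0 x1'.
  by rewrite ler_norml; apply/andP; split; lra.
have /fin_all_exists[idx idxP] :
    forall j, exists l, e.+1%:R^-1 <= `|line (p, q) b r (f j) (lift ord0 l)|.
  move=> j; apply: pencil_slope (x1 j) (hit' j); exact: pencil_pivot.
exists ([ffun j => f j], (p, q), b, [ffun j => idx j],
        [ffun j => inord (Y (j, idx j) %% slack)]), r; split.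
- by move=> [[i|i]|i] //=; have [] := gP i.
- move=> j; rewrite ffunE -[X in `|X|]subr0 -[X in _ - X](hit' j) -sumrB.
  under eq_bigr do rewrite -mulrBr.
  rewrite -[X in _ * X%:R]card_ord; apply: norm_sum_le => k; last exact: hom_dist.
  by rewrite lineE; apply: pencil_le2 => //; have [] := gP (f j).
- by move=> j; rewrite !ffunE.
- by move=> j; rewrite !ffunE.
Qed.

(** For |x| <= 1 the floor of (x + 1)n lies between 0 and 2n, so 2n + 1 values suffice and [inord]
    does not fall back on its default. *)
Let round (x : R) : 'I_(n.*2).+1 := inord (Num.truncn ((x + 1) * n%:R)).

Let round_dist (x y : R) : `|x| <= 1 -> `|y| <= 1 -> round x = round y ->
  `|x - y| <= n%:R^-1.
Proof.
have n0 : 0 < n%:R :> R by rewrite ltr0n.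
have roundP (z : R) : `|z| <= 1 ->
    (round z : nat)%:R <= (z + 1) * n%:R < (round z : nat).+1%:R.
  rewrite ler_norml => /andP[z1 z2].
  have z0 : 0 <= (z + 1) * n%:R by apply: mulr_ge0; lra.
  rewrite /round inordK; first exact: truncn_itv.
  rewrite ltnS truncn_le_nat; apply: (@le_lt_trans _ _ (n.*2)%:R).
    by rewrite -muln2 mulnC natrM ler_wpM2r//; lra.
  by rewrite ltr_nat.
move=> /roundP/andP[x1 x2] /roundP/andP[y1 y2] xy.
rewrite -[n%:R^-1]mul1r ler_pdivlMr// -[X in _ * X <= _](gtr0_norm n0) -normrM ler_norml mulrBl.
move: x1 x2 y1 y2; rewrite xy -natr1.
by rewrite !mulrDl !mul1r; move: (_ * _) (_ * _) (_%:R) => a b c *; apply/andP; split; lra.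
Qed.

Lemma nearly_hit_count :
  (forall Y : {ffun 'I_N * 'I_e.+1 -> 'I_n}, exists c r, nearly_hit Y c r) ->
  (n ^ (N * e.+1) <= #|skeleton| * (n.*2.+1 ^ (e + e + m) * n ^ (N * e)))%N.
Proof.
move=> /fin_all_exists[c /fin_all_exists[r hitP]].
(* The last component keeps every coordinate of each cube but the steep one, hence the exponent N
   e. *)
pose code (Y : {ffun 'I_N * 'I_e.+1 -> 'I_n}) :
    (skeleton * ({ffun parameter -> 'I_(n.*2.+1)} * {ffun 'I_N * 'I_e -> 'I_n}))%type :=
  (c Y, ([ffun k => round (r Y k)],
         [ffun jl => Y (jl.1, lift ((c Y).1.2 jl.1) jl.2)])).
have code_inj : injective code.
  move=> Y Y' [cE /ffunP rE /ffunP YE].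
  have hY := hitP Y; have hY' := hitP Y'; rewrite -cE in hY'.
  apply/ffunP; apply: nearly_hit_inj hY hY' _ _.
    move=> k; apply: round_dist; last by have := rE k; rewrite !ffunE.
      by have := hitP Y; case: (c Y) => [[[[f pq] b] idx] rho] [].
    by have := hitP Y'; case: (c Y') => [[[[f pq] b] idx] rho] [].
  by move=> j l; have := YE (j, l); rewrite !ffunE/= cE.
have := leq_card code code_inj.
by rewrite !card_prod !card_ffun !card_prod !card_sum !card_ord.
Qed.
End Counting.

Lemma generic_grid (R : archiRealFieldType) (e m N : nat) : (e + e + m < N)%N ->
  exists2 n, (0 < n)%N & exists Y : 'I_N * 'I_e.+1 -> 'I_n,
  forall (b1 b2 : 'I_e.+2 -> R) (s t : 'I_m -> R) (f : 'I_N -> 'I_m)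
      (x : 'I_N -> 'I_e.+1 -> R),
  (exists k l, b1 k * b2 l != b1 l * b2 k) ->
  (forall i, exists k, s i * b1 k + t i * b2 k != 0) ->
  (forall j l, (Y (j, l))%:R / n%:R <= x j l <= (Y (j, l)).+1%:R / n%:R) ->
  exists j, \sum_k (s (f j) * b1 k + t (f j) * b2 k) * hom (x j) k != 0.
Proof.
(* One more than the constant C for which cancelling powers of [n] in the count leaves n <= C. *)
move=> emN; pose n := (#|skeleton e m N| * 3 ^ (e + e + m)).+1.
have n0 : (0 < n)%N by [].
exists n => //; apply: contrapT => H.
have : (n ^ (N * e.+1) <= #|skeleton e m N| * (n.*2.+1 ^ (e + e + m) * n ^ (N * e)))%N.
  apply: (@nearly_hit_count R) => // Y; apply: contrapT => notH.
  apply: H; exists Y => b1 b2 s t f x indep nz xY; apply: contrapT => hit.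
  apply: notH; apply: (nearly_hit_intro (f := f) (x := x) n0 indep nz xY) => j.
  by apply/eqP/negPn/negP => Hj; apply: hit; exists j.
(* The factor n^(N e) cancels, leaving n^N <= #|skeleton| (2n + 1)^(2e + m), where 2n + 1 <= 3n and
   N > 2e + m. *)
rewrite mulnS expnD mulnA leq_pmul2r ?expn_gt0 ?n0//.
have n3 : (n.*2.+1 <= 3 * n)%N by rewrite -muln2; lia.
have nN : (n ^ (e + e + m) * n <= n ^ N)%N by rewrite -expnSr leq_pexp2l.
have n2 : (n.*2.+1 ^ (e + e + m) <= 3 ^ (e + e + m) * n ^ (e + e + m))%N.
  by rewrite -expnMn; case: (e + e + m)%N => // k; rewrite leq_exp2r.
move=> n1; have := leq_trans nN (leq_trans n1 (leq_mul (leqnn _) n2)).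
by rewrite mulnA [leqRHS]mulnC leq_pmul2l ?expn_gt0 ?n0// ltnn.
Qed.

(** * Connectedness in normed spaces *)

Section Connectedness.
Variables (R : realType) (V : normedModType R).
Implicit Types (A : set V) (x y : V).

(** The set is the union of the segments issuing from one of its points. *)
Lemma segment_convex_connected A :
  (forall x y t, A x -> A y -> 0 <= t <= 1 -> A (x + t *: (y - x))) -> connected A.
Proof.
move=> Aconv; have [->|/set0P[x Ax]] := eqVneq A set0; first exact: connected0.
pose seg y := (fun t : R => x + t *: (y - x)) @` `[0, 1].
have -> : A = \bigcup_(y in A) seg y.
  apply/seteqP; split=> [y Ay|_ [y Ay [t t01 <-]]].
    by exists y => //; exists 1; rewrite /= ?in_itv/= ?lexx ?ler01// scale1r subrKC.
  by apply: Aconv => //; move: t01; rewrite /= in_itv.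
apply: bigcup_connected.
  by exists x => y _; exists 0; rewrite /= ?in_itv/= ?lexx ?ler01// scale0r addr0.
move=> y _; apply: connected_continuous_connected; first exact: segment_connected.
apply: continuous_subspaceT => t.
by apply: cvgD; [exact: cvg_cst|apply: cvgZr_tmp; exact: cvg_id].
Qed.

Lemma ball_connected x (r : R) : connected (ball x r).
Proof.
apply: segment_convex_connected => y z t; rewrite -ball_normE /= => xy xz /andP[t0 t1].
have -> : x - (y + t *: (z - y)) = (1 - t) *: (x - y) + t *: (x - z).
  rewrite [in RHS]scalerBl scale1r -addrA [- _ + _]addrC -scalerBr.
  by rewrite [- (x - y)]opprB [_ + (y - x)]addrC subrKA opprD -scalerN opprB addrA.
apply: le_lt_trans (ler_normD _ _) _; rewrite !normrZ (ger0_norm t0) ger0_norm ?subr_ge0//.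
apply: (@le_lt_trans _ _ (Num.max `|x - y| `|x - z|)); last by rewrite gt_max xy.
by move: `|_| `|_| => a b; case: (leP b a) => ab; nra.
Qed.

(** A ball inside [A] around a point of the component is connected, so it stays in the component.
    This makes the parts cut out by a fan measurable. *)
Lemma open_connected_component A x : open A -> open (connected_component A x).
Proof.
rewrite !openE => Ao y Cy.
have /Ao/nbhs_ballP[r /= r0 rA] : A y := connected_component_sub Cy.
apply/nbhs_ballP; exists r => //= z yz.
apply: connected_component_trans Cy _.
by apply: (connected_component_max _ rA (ball_connected (x := y) (r := r)) yz); exact: ballxx.
Qed.
End Connectedness.

(** * Borel sets and measurable maps into the space of row vectors *)

Section Borel.
Variables (R : realType) (n : nat).

Lemma open_measurable_Rd (U : set 'rV[R]_n) : open U -> measurable (U : set (Rd_borel R n)).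
Proof. exact: sub_sigma_algebra. Qed.

Lemma closed_measurable_Rd (A : set 'rV[R]_n) : closed A -> measurable (A : set (Rd_borel R n)).
Proof.
by move=> Ac; rewrite -[A]setCK; apply: measurableC; apply: open_measurable_Rd; exact: closed_openC.
Qed.

Definition box (a b : 'I_n -> R) : set 'rV[R]_n :=
  [set x | forall i, a i <= x ord0 i <= b i].

Lemma box_closed a b : closed (box a b).
Proof.
have -> : box a b = \bigcap_i (fun x : 'rV[R]_n => x ord0 i) @^-1` `[a i, b i].
  apply/seteqP; split=> [x xab i _|x xab i]; first by rewrite /= in_itv; exact: xab.
  by have := xab i I; rewrite /= in_itv.
apply: closed_bigI => i _; apply: closed_comp; last exact: itv_closed.
by move=> x _; exact: coord_continuous.
Qed.

Lemma box_connected a b : connected (box a b).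
Proof.
apply: segment_convex_connected => x y t xab yab /andP[t0 t1] i.
have /andP[x1 x2] := xab i; have /andP[y1 y2] := yab i.
by rewrite !mxE; apply/andP; split; nra.
Qed.

Lemma measurable_fun_rV d (T : measurableType d) (f : T -> 'rV[R]_n) :
  (forall i, measurable_fun setT (fun t => f t ord0 i)) ->
  measurable_fun setT (f : T -> Rd_borel R n).
Proof.
move=> mf; apply: (@measurability _ _ _ (Rd_borel R n) setT f (@open 'rV[R]_n)) => // _ [U Uo <-].
rewrite setTI.
(* An open set is the union of the countably many cubes with rational centre and radius 1/(k + 1)
   that it contains. *)
pose B (qk : 'rV[rat]_n * nat) := [set x : 'rV[R]_n |
  forall i, ratr (qk.1 ord0 i) - qk.2.+1%:R^-1 < x ord0 i < ratr (qk.1 ord0 i) + qk.2.+1%:R^-1].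
have -> : f @^-1` U = \bigcup_(qk : 'rV[rat]_n * nat)
    (if `[< B qk `<=` U >] then f @^-1` B qk else set0).
  apply/seteqP; split=> [t /= Uft|t [qk _]]; last first.
    by case: asboolP => // BU; exact: BU.
  have := Uo; rewrite openE => /(_ _ Uft) /nbhs_ballP[r /= r0 rU].
  (* Two points of a cube of radius below r/2 are at distance less than r. *)
  have [k kr] : exists k, k.+1%:R^-1 < r / 2.
    have r2 : 0 < r / 2 by rewrite divr_gt0.
    exists (Num.truncn (r / 2)^-1); rewrite -[ltRHS]invrK ltf_pV2 ?posrE ?invr_gt0//.
    exact: truncnS_gt.
  have k0 : 0 < k.+1%:R^-1 :> R by rewrite invr_gt0.
  have /fin_all_exists[q qP] : forall i, exists q : rat,
      f t ord0 i - k.+1%:R^-1 < ratr q < f t ord0 i + k.+1%:R^-1.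
    move=> i; have /rat_in_itvoo[q] : f t ord0 i - k.+1%:R^-1 < f t ord0 i + k.+1%:R^-1.
      by rewrite (@lt_trans _ _ (f t ord0 i))// ?gtrBl ?ltrDl.
    by rewrite in_itv; exists q.
  have tB : B (\row_i q i, k) (f t).
    by move=> i /=; rewrite mxE; move: (_^-1) (ratr _) (f _ _ _) (qP i) => h a b; lra.
  exists (\row_i q i, k) => //; case: asboolP => // notBU; exfalso; apply: notBU.
  move=> x xB; apply: rU; split=> // i j; rewrite ord1 /ball/=.
  move: (xB j) (tB j); rewrite /= mxE ltr_distlC.
  by move: (_^-1) (ratr _) (f _ _ _) (x _ _) kr => h a b c; lra.
apply: countable_bigcupT_measurable => // qk; case: asboolP => // _.
have -> : f @^-1` B qk = \bigcap_i ((fun t => f t ord0 i) @^-1`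
   `]ratr (qk.1 ord0 i) - qk.2.+1%:R^-1, ratr (qk.1 ord0 i) + qk.2.+1%:R^-1[).
  apply/seteqP; split=> [t tB i _|t tB i]; first by rewrite /= in_itv; exact: tB.
  by have := tB i I; rewrite /= in_itv.
apply: fin_bigcap_measurable => // i _.
by rewrite -[X in measurable X]setTI; exact: mf.
Qed.
End Borel.

(** * Averages of finitely many probability measures *)

Section Mixture.
Context d (T : measurableType d) (R : realType).
Variables (P : nat -> probability T R) (N : nat).
Local Open Scope ereal_scope.

Definition mixture : set T -> \bar R := mscale (N.+1%:R^-1)%:nng%R (msum P N.+1).

HB.instance Definition _ := Measure.on mixture.

Lemma mixtureE A : mixture A = (N.+1%:R^-1)%R%:E * \sum_(k < N.+1) P k A.
Proof. by []. Qed.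

Let mixture_setT : mixture [set: T] = 1.
Proof.
rewrite mixtureE (eq_bigr (fun=> 1)) => [|k _]; last exact: probability_setT.
by rewrite sumEFin -EFinM sumr_const card_ord mulVf.
Qed.

HB.instance Definition _ := Measure_isProbability.Build _ _ _ mixture mixture_setT.

Lemma mixture_ge k A : (k < N.+1)%N -> P k A = 1 -> (N.+1%:R^-1)%R%:E <= mixture A.
Proof.
move=> kN PA; rewrite mixtureE -[leLHS]mule1 lee_wpmul2l//.
rewrite (bigD1 (Ordinal kN))//= PA leeDl// sume_ge0//.
Qed.
End Mixture.

(** * Uniform measures on cubes and absolute continuity *)

Section Cube.
Variable R : realType.

Lemma coord_measurable_Rd n (i : 'I_n) :
  measurable_fun setT (fun v : Rd_borel R n => (v : 'rV[R]_n) ord0 i).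
Proof.
apply: (measurability _ (RGenOpens.measurableE R)).
move=> _ [_ [a [b ->]] <-]; rewrite setTI; apply: open_measurable_Rd.
by apply: open_comp; [move=> x _; exact: coord_continuous|exact: itv_open].
Qed.

Lemma uniform_prob_itv_le (z z' : R) (zz' : z < z') (a b : R) : a <= b ->
  (uniform_prob zz' `[a, b]%classic <= ((b - a) / (z' - z))%:E)%E.
Proof.
move=> ab.
apply: (@le_trans _ _ (\int[lebesgue_measure]_(x in `[a, b]) (z' - z)^-1%:E)%E).
  apply: ge0_le_integral => //=.
  - by move=> x _; rewrite lee_fin uniform_pdf_ge0.
  - by apply/measurable_EFinP/measurable_funTS; exact: measurable_uniform_pdf.
  - move=> x _; rewrite lee_fin /uniform_pdf; case: ifP => // _.
    by rewrite invr_ge0 subr_ge0 ltW.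
rewrite integral_cst//= lebesgue_measure_itv/= lte_fin.
case: ltP => [_|ba]; first by rewrite -EFinD -EFinM mulrC.
by rewrite mule0 lee_fin divr_ge0 ?subr_ge0// ltW.
Qed.

(** Induction on the dimension: the law of a uniform first coordinate followed by an independent
    vector from the lower-dimensional cube. Boxes are products, so their masses multiply. *)
Lemma cube_probability n (z : 'I_n -> R) (h : R) : 0 < h ->
  exists P : probability (Rd_borel R n) R,
    (forall a b, (forall i, a i <= b i) ->
       (P (box a b : set (Rd_borel R n)) <= (\prod_i ((b i - a i) / h))%:E)%E) /\
    P (box z (fun i => z i + h) : set (Rd_borel R n)) = 1%E.
Proof.
move=> h0; elim: n z => [|n IH] z.
  have boxT a b : box a b = [set: 'rV[R]_0] by apply/seteqP; split=> // x _ [].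
  exists \d_(0 : Rd_borel R 0); split=> [a b _|]; last first.
    by rewrite boxT; exact: probability_setT.
  by rewrite big_ord0 probability_le1// boxT.
have [P [P_le P1]] := IH (fun l => z (lift ord0 l)).
have zh : z ord0 < z ord0 + h by rewrite ltrDl.
pose X (tv : measurableTypeR R * Rd_borel R n) : Rd_borel R n.+1 :=
  \row_i (if unlift ord0 i is Some l then (tv.2 : 'rV[R]_n) ord0 l else tv.1).
have mX : measurable_fun setT X.
  apply: measurable_fun_rV => i.
  case: (unliftP ord0 i) => [l|] ->.
    rewrite (_ : (fun _ => _) = (fun v : Rd_borel R n => (v : 'rV[R]_n) ord0 l) \o snd).
      by apply: measurableT_comp => //; exact: coord_measurable_Rd.
    by apply/funext => tv; rewrite mxE liftK.
  rewrite (_ : (fun _ => _) = fst)//.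
  by apply/funext => tv; rewrite mxE unlift_none.
pose mfX := isMeasurableFun.Build _ _ _ _ X mX.
pose XX : {mfun (measurableTypeR R * Rd_borel R n)%type >-> Rd_borel R n.+1} := HB.pack X mfX.
pose Q : probability _ R := distribution (uniform_prob zh \x P)%E XX.
have QE a b : Q (box a b : set (Rd_borel R n.+1)) =
  (uniform_prob zh `[a ord0, b ord0]%classic *
   P (box (fun l => a (lift ord0 l)) (fun l => b (lift ord0 l)) : set (Rd_borel R n)))%E.
  rewrite -product_measure1E//; last by apply: closed_measurable_Rd; exact: box_closed.
  rewrite /Q /distribution /pushforward /=; congr (_ _).
  apply/seteqP; split=> [[t v] /= tv|[t v] /= [tab vab] i].
    split=> [|l]; first by have := tv ord0; rewrite mxE unlift_none in_itv.
    by have := tv (lift ord0 l); rewrite mxE liftK.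
  by rewrite mxE; case: unliftP => [l ->|->]; [exact: vab|move: tab; rewrite in_itv].
exists Q; split=> [a b ab|]; rewrite QE.
  rewrite big_ord_recl EFinM; apply: lee_pmul => //; last exact: P_le.
  by have := uniform_prob_itv_le zh (ab ord0); rewrite addrAC subrr add0r.
rewrite P1 mule1 /uniform_prob; exact: integral_uniform_pdf1.
Qed.

Lemma box_bound_abs_cont n (h : R) (mu : probability (Rd_borel R n) R) : 0 < h ->
  (forall a b, (forall i, a i <= b i) ->
     (mu (box a b : set (Rd_borel R n)) <= (\prod_i ((b i - a i) / h))%:E)%E) ->
  abs_cont_lebesgue mu.
Proof.
move=> h0 mu_le A mA A0; apply/eqP; rewrite eq_le measure_ge0 andbT.
apply/lee_addgt0Pr => e e0; rewrite add0e.
have hn : 0 < h ^+ n by rewrite exprn_gt0.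
(* The tolerance e h^n on the volume absorbs the factor h^-n in the bound for boxes. *)
have [a [b [ab [Aab sum_lt]]]] := A0 (e * h ^+ n) (mulr_gt0 e0 hn).
pose F k := box (a k ord0) (b k ord0) : set (Rd_borel R n).
apply: (@le_trans _ _ (\sum_(0 <= k <oo) mu (F k))%E).
  apply: measure_sigma_subadditive => // k; by apply: closed_measurable_Rd; exact: box_closed.
apply: (@le_trans _ _ (\sum_(0 <= k <oo)
    ((h ^+ n)^-1%:E * (\prod_(i < n) (b k ord0 i - a k ord0 i))%:E))%E).
  apply: lee_nneseries => // k _; apply: le_trans (mu_le _ _ (ab k)) _.
  by rewrite -EFinM lee_fin prodf_div prodr_const card_ord mulrC.
rewrite nneseriesZl; last first.
  by move=> k _; rewrite lee_fin prodr_ge0// => i _; rewrite subr_ge0.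
apply: (@le_trans _ _ ((h ^+ n)^-1%:E * (e * h ^+ n)%:E)%E).
  by apply: lee_wpmul2l; [rewrite lee_fin invr_ge0 ltW|exact: ltW].
by rewrite -EFinM lee_fin mulrC mulfK// gt_eqF.
Qed.
End Cube.

Lemma mixture_abs_cont (R : realType) n (P : nat -> probability (Rd_borel R n) R) N :
  (forall k, abs_cont_lebesgue (P k)) -> abs_cont_lebesgue (mixture P N).
Proof.
move=> acP A mA A0.
by rewrite /= mixtureE big1 ?mule0// => k _; exact: acP.
Qed.

(** * Linear algebra of the hyperplanes of a fan *)

Lemma row_free2_minor (F : fieldType) n (B : 'M[F]_(2, n)) : row_free B ->
  exists k l, B 0 k * B 1 l != B 0 l * B 1 k.
Proof.
move=> Bfree; apply: contrapT => minor0.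
have minorE k l : B 0 k * B 1 l = B 0 l * B 1 k.
  by apply/eqP/negPn/negP => kl; apply: minor0; exists k, l.
have ker (u : 'rV[F]_2) : u *m B = 0 -> u = 0.
  by move=> uB; apply: (row_free_inj Bfree); rewrite uB mul0mx.
have mulE (u : 'rV[F]_2) k : (u *m B) 0 k = u 0 0 * B 0 k + u 0 1 * B 1 k.
  by rewrite mxE !big_ord_recl big_ord0 addr0; congr (_ * _ + _ * _); congr (_ _ _); apply: val_inj.
have B10 l : B 1 l = 0 /\ B 0 l = 0.
  (* All minors being zero, this combination of the rows of [B] vanishes, so its coefficients do,
     and column [l] of [B] is zero. *)
  have : (\row_(i < 2) (if i == 0 then B 1 l else - B 0 l)) = 0 :> 'rV[F]_2.
    by apply: ker; apply/rowP => k; rewrite mulE !mxE /= mulNr mulrC minorE subrr.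
  move=> /rowP u0; have := u0 0; have := u0 1; rewrite !mxE /= => /eqP.
  by rewrite oppr_eq0 => /eqP.
have : (const_mx 1 : 'rV[F]_2) = 0.
  by apply: ker; apply/rowP => k; rewrite mulE; have [-> ->] := B10 k; rewrite !mulr0 addr0 mxE.
by move/rowP/(_ 0)/eqP; rewrite !mxE oner_eq0.
Qed.

(* [b1 ord0], [b2 ord0] are offsets and the other coordinates normals, so that
   hyperplane number [i] is the zero set of [s i * b1 + t i * b2] in the
   homogeneous coordinates of [hom]. *)
Lemma mfan_pencil (R : realType) e m (a : 'I_m -> 'rV[R]_e.+1) c :
  (0 < e)%N -> is_mfan a c ->
  exists (b1 b2 : 'I_e.+2 -> R) (s t : 'I_m -> R),
    [/\ exists k l, b1 k * b2 l != b1 l * b2 k,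
     forall i, s i * b1 ord0 + t i * b2 ord0 = c i &
     forall i l, s i * b1 (lift ord0 l) + t i * b2 (lift ord0 l) = a i ord0 l].
Proof.
move=> e0 [_ [_ [p [F [rF sub]]]]].
have pc i : (a i *m p^T) 0 0 = c i.
  have : hyperplane (a i) (c i) p by apply: sub; rewrite /flat /= subrr sub0mx.
  by rewrite /hyperplane /= => <-; rewrite mxE; apply: eq_bigr => l _; rewrite mxE.
(* Moving from [p] along a row of [F] stays in the flat, so every normal is orthogonal to the rows
   of [F]. *)
have aF i : (a i <= kermx F^T)%MS.
  apply/sub_kermxP/rowP => j; rewrite !mxE.
  have : hyperplane (a i) (c i) (p + row j F).
    by apply: sub; rewrite /flat /= addrC addKr row_sub.
  rewrite /hyperplane /= -(pc i) mxE.
  under eq_bigr do rewrite mxE mulrDr.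
  rewrite big_split/= => /eqP; rewrite -subr_eq0 addrAC.
  under [X in _ - X]eq_bigr do rewrite mxE.
  rewrite subrr add0r => /eqP sum0; rewrite -[RHS]sum0.
  by apply: eq_bigr => l _; rewrite !mxE.
(* The dimension is (e + 1) - (e - 1); [e0] keeps the truncated subtraction d - 2 exact. *)
have rk : \rank (kermx F^T) = 2%N by rewrite mxrank_ker mxrank_tr rF; lia.
have [B [Bfree aB]] : exists B : 'M[R]_(2, e.+1), row_free B /\ forall i, (a i <= B)%MS.
  rewrite -rk; exists (row_base (kermx F^T)); split; first exact: row_base_free.
  by move=> i; rewrite eq_row_base.
have [k [l kl]] := row_free2_minor Bfree.
have /fin_all_exists[D aE] : forall i, exists D, a i = D *m B.
  by move=> i; exact/submxP.
(* The offset of a basis form is its value at [p], a point common to all the hyperplanes. *)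
pose b r (x : 'I_e.+2) := if unlift ord0 x is Some y then B r y else (B *m p^T) r 0.
exists (b 0), (b 1), (fun i => D i 0 0), (fun i => D i 0 1).
have sum2 (f : 'I_2 -> R) : \sum_i f i = f 0 + f 1.
  by rewrite !big_ord_recl big_ord0 addr0; congr (_ + f _); apply: val_inj.
split.
- by exists (lift ord0 k), (lift ord0 l); rewrite /b !liftK.
- by move=> i; rewrite /b unlift_none -pc aE -mulmxA [RHS]mxE sum2.
- by move=> i x; rewrite /b liftK aE mxE sum2.
Qed.

(** * The complement of a fan and the final contradiction *)

Lemma hyperplane_closed (R : realType) d (a : 'rV[R]_d) c : closed (hyperplane a c).
Proof.
pose f (x : 'rV[R]_d) : R := \sum_(i < d) a ord0 i * x ord0 i.
have -> : hyperplane a c = f @^-1` [set c] by [].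
have fC : continuous f.
  apply: continuous_big => [|i _ y]; first exact: add_continuous.
  apply: (@continuous_comp _ _ _ (fun x : 'rV[R]_d => x ord0 i) ( *%R (a ord0 i))).
    exact: coord_continuous.
  exact: mulrl_continuous.
by apply: closed_comp; [move=> x _; exact: fC|exact: closed_eq].
Qed.

Lemma fan_complement_open (R : realType) d m (a : 'I_m -> 'rV[R]_d) c :
  open (fan_complement a c).
Proof.
apply: closed_openC; apply: closed_bigcup => [|i _]; first exact: finite_finset.
exact: hyperplane_closed.
Qed.

Unset Implicit Arguments.

Theorem theorem8 (R : realType) (d m : nat) :
  (2 <= d)%N -> (2 * d <= m)%N ->
  exists mu : probability (Rd_borel R d) R,
    abs_cont_lebesgue mu /\
    forall (a : 'I_m -> 'rV[R]_d) (c : 'I_m -> R),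
      is_mfan a c -> ~ fan_equipartitions mu a c.
Proof.
case: d => // e e0 em; pose N := (2 * m).-2.
have NE : N.+2 = (2 * m)%N by rewrite /N; lia.
(* The side condition 2e + m < N + 1 = 2m - 1 amounts to m >= 2(e + 1). *)
have [n n0 [Y Ygen]] := @generic_grid R e m N.+1 ltac:(lia).
have h0 : 0 < n%:R^-1 :> R by rewrite invr_gt0 ltr0n.
pose z (j : 'I_N.+1) (l : 'I_e.+1) : R := (Y (j, l))%:R / n%:R.
pose Q j := box (z j) (fun l => z j l + n%:R^-1).
have /choice[P PP] := fun k : nat => cube_probability (z (inord k)) h0.
have PQ (j : 'I_N.+1) : P j (Q j : set (Rd_borel R e.+1)) = 1%E.
  by have [_] := PP j; rewrite inord_val.
exists (mixture P N); split.
  by apply: mixture_abs_cont => k; have [Pk _] := PP k; exact: box_bound_abs_cont h0 Pk.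
move=> a c fan [_ eqpart].
have [b1 [b2 [s [t [indep cE aE]]]]] := mfan_pencil e0 fan.
have /fin_all_exists[f] : forall j : 'I_N.+1, exists i, exists x, Q j x /\ hyperplane (a i) (c i) x.
  move=> j; apply: contrapT => miss.
  set U := fan_complement a c in eqpart.
  have QU : Q j `<=` U.
    by move=> x Qx [i _ ix]; apply: miss; exists i, x.
  have Qz : Q j (\row_l z j l) by move=> l; rewrite mxE lexx lerDl ltW.
  set C := connected_component U (\row_l z j l).
  have mC : measurable (C : set (Rd_borel R e.+1)).
    by apply: open_measurable_Rd; apply: open_connected_component; exact: fan_complement_open.
  have QC : Q j `<=` C.
    by apply: connected_component_max => //; exact: box_connected.
  have PC : P j (C : set (Rd_borel R e.+1)) = 1%E.
    apply/eqP; rewrite eq_le probability_le1//= -(PQ j) le_measure ?inE//.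
    by apply: closed_measurable_Rd; exact: box_closed.
  (* The component has mass at least 1/(N + 1), but an equal part has mass 1/(N + 2). *)
  have := mixture_ge (ltn_ord j) PC.
  rewrite (eqpart _ (QU _ Qz)) lee_fin lef_pV2 ?posrE ?ltr0n//; last by lia.
  by rewrite ler_nat; lia.
move=> /fin_all_exists[x Qx].
have [||j] := Ygen b1 b2 s t f (fun j l => x j ord0 l) indep.
(* If the combination were zero, so would be the normal [a i], which a fan excludes. *)
- move=> i; apply: contrapT => allz; have [/(_ i)/negP[]] := fan.
  apply/eqP/rowP => l; rewrite mxE -aE; apply/eqP/negPn/negP => nz.
  by apply: allz; exists (lift ord0 l).
- by move=> j l; have [/(_ l) + _] := Qx j; rewrite -natr1 mulrDl mul1r.
(* The form that [Ygen] makes nonzero is the equation of hyperplane [f j] at [x j], which lies on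
   it. *)
rewrite sum_hom cE; have [_ <-] := Qx j.
under [X in _ + X]eq_bigr do rewrite aE.
by rewrite addNr eqxx.
Qed.
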